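(* Let $D=(V,A)$ be a digraph (parallel arcs allowed), $\{S,T\}$ a partition of $V$ with $S,T\neq\emptyset$ such that $D$ has no arc from $T$ to $S$, and $b\in\mathbb{Z}_{>0}^V$. Then the maximum number of pairwise arc-disjoint $b$-bibranchings in $D$ equals the minimum of the three quantities $$\min_{v\in T}\left\lfloor \frac{d^-_A(v)}{b(v)}\right\rfloor,\qquad \min_{v\in S}\left\lfloor \frac{d^+_A(v)}{b(v)}\right\rfloor,\qquad \min\{|C|: C\text{ a bicut}\}.$$
   Context: Digraphs are loopless. $d^-_B(v)$, $d^+_B(v)$ are the numbers of arcs of $B\subseteq A$ entering/leaving $v$; $\delta^-(U)$ is the set of arcs of $A$ entering $U$. A bicut is $\delta^-(U)$ for some $U$ with $\emptyset\neq U\subseteq T$ or $T\subseteq U\subsetneq V$. An arc set $B\subseteq A$ is a $b$-bibranching if (i) every vertex of $T$ is reachable in $(V,B)$ from some vertex of $S$, (ii) every vertex of $S$ reaches some vertex of $T$ in $(V,B)$, (iii) $d^-_B(v)\ge b(v)$ for all $v\in T$, and (iv) $d^+_B(u)\ge b(u)$ for all $u\in S$. *)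

(* Defs.v *)
From mathcomp Require Import all_boot.
Set Implicit Arguments. Unset Strict Implicit. Unset Printing Implicit Defensive.

Definition din (V A : finType) (tail head : A -> V) (B : {set A}) (v : V) : nat :=
  #|[set a in B | head a == v]|.
Definition dout (V A : finType) (tail head : A -> V) (B : {set A}) (v : V) : nat :=
  #|[set a in B | tail a == v]|.

Definition arcrel (V A : finType) (tail head : A -> V) (B : {set A}) : rel V :=
  fun x y => [exists a in B, (tail a == x) && (head a == y)].

Definition reach (V A : finType) (tail head : A -> V) (B : {set A}) (x y : V) : bool :=
  connect (arcrel tail head B) x y.

Definition delta_in (V A : finType) (tail head : A -> V) (U : {set V}) : {set A} :=
  [set a | (head a \in U) && (tail a \notin U)].

Definition bicut_set (V : finType) (T U : {set V}) : bool :=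
  ((U != set0) && (U \subset T)) || ((T \subset U) && (U != setT)).

Definition is_bibranching (V A : finType) (tail head : A -> V)
  (S T : {set V}) (b : V -> nat) (B : {set A}) : Prop :=
  [/\ (forall v, v \in T -> exists2 s, s \in S & reach tail head B s v),
      (forall u, u \in S -> exists2 t, t \in T & reach tail head B u t),
      (forall v, v \in T -> b v <= din tail head B v) &
      (forall u, u \in S -> b u <= dout tail head B u)].

Definition k_disjoint_bibranchings (V A : finType) (tail head : A -> V)
  (S T : {set V}) (b : V -> nat) (k : nat) : Prop :=
  exists F : 'I_k -> {set A},
    (forall i, is_bibranching tail head S T b (F i)) /\
    (forall i j, i != j -> [disjoint F i & F j]).

(* the min of the three quantities; #|A| is a harmless identity element since
   every term is at most #|A| and each index range is nonempty when S,T <> set0 *)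
Definition bibranch_bound (V A : finType) (tail head : A -> V)
  (S T : {set V}) (b : V -> nat) : nat :=
  minn (minn (\big[minn/#|A|]_(v in T) (din tail head [set: A] v %/ b v))
             (\big[minn/#|A|]_(u in S) (dout tail head [set: A] u %/ b u)))
       (\big[minn/#|A|]_(U : {set V} | bicut_set T U) #|delta_in tail head U|).

(* Main.v *)
Require Import Defs.
From mathcomp Require Import all_boot all_order all_algebra zify.
Set Implicit Arguments. Unset Strict Implicit. Unset Printing Implicit Defensive.
Import Order.TTheory GRing.Theory Num.Theory.

(** Write [k] for the bound. Grouping the arcs entering [v \in T] into [b v] disjoint
    groups of size at least [k] turns the degree condition into "every colour
    enters every group"; together with the sets [U \subset T] these groups form an
    intersecting family [kernel], each member of which is entered by at least [k]
    arcs. The same holds for [S] in the reversed digraph.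

    The arcs from [S] to [T] are coloured first, so that each member [X] of either
    family sees at least [k - d(X)] colours, where [d(X)] counts the arcs inside the
    side that enter [X]: this is Schrijver's supermodular colouring theorem. As in
    Tardos's proof, the classes are split off one at a time, each being a common
    integral point of two generalized polymatroids (the vector [1/k] is a fractional
    one). The arcs inside [T] and inside [S] are then coloured independently, by
    Lovász's argument for Edmonds' disjoint branchings in Frank's setting of kernel
    systems. *)

(** * Integral intersection of generalized polymatroids *)

Local Open Scope ring_scope.

(** Frank's strong pairs: the vectors [x] with [p X <= x(X) <= q X] for all [X \subset D] form a
    generalized polymatroid, and [sp_cross] is the inequality that ties [p] to [q]. *)
Record strong_pair (A : finType) (D : {set A}) (p q : {set A} -> int) : Prop := StrongPair {
  sp_p0 : p set0 = 0;
  sp_q0 : q set0 = 0;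
  sp_super : forall X Y : {set A}, X \subset D -> Y \subset D ->
    p X + p Y <= p (X :&: Y) + p (X :|: Y);
  sp_sub : forall X Y : {set A}, X \subset D -> Y \subset D ->
    q (X :&: Y) + q (X :|: Y) <= q X + q Y;
  sp_cross : forall X Y : {set A}, X \subset D -> Y \subset D ->
    q (X :\: Y) - p (Y :\: X) <= q X - p Y }.

Lemma int_separation (I : finType) (lo up : I -> int) (i0 : I) :
  (forall i j, lo i <= up j) -> exists t, forall i, (lo i <= t) && (t <= up i).
Proof.
move=> lu; case: (@arg_maxP _ _ I i0 xpredT lo isT) => m _ mP.
by exists (lo m) => i; rewrite lu andbT; apply: mP.
Qed.

Section FixCoordinate.
Variables (A : finType) (e : A) (t : int).
(** With coordinate [e] set to [t], a set [X] avoiding [e] is bounded both directly and through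
    [e |: X]; the section keeps the stronger bound. *)
Definition sec_lo (p : {set A} -> int) X := Num.max (p X) (p (e |: X) - t).
Definition sec_up (q : {set A} -> int) X := Num.min (q X) (q (e |: X) - t).

(** Each inequality splits by the terms attaining the maxima and minima, and each case is an
    instance for [X] or [e |: X] against [Y] or [e |: Y]. The range of [t] gives the empty set the
    value 0. *)
Lemma strong_pair_section (D : {set A}) p q : e \in D -> strong_pair D p q ->
  p [set e] <= t <= q [set e] ->
  strong_pair (D :\ e) (sec_lo p) (sec_up q).
Proof.
move=> eD [p0 q0 sup sub cross] /andP[pt tq].
have up (X : {set A}) : X \subset D :\ e -> [/\ X \subset D, e |: X \subset D & e \notin X].
  rewrite subsetD1 => /andP[XD eX]; split => //.
  by rewrite subUset sub1set eD XD.
split; rewrite /sec_lo /sec_up.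
- by rewrite setU0 p0; lia.
- by rewrite setU0 q0; lia.
- move=> X Y /up[XD eXD eX] /up[YD eYD eY].
  have h1 := sup _ _ XD YD; have h2 := sup _ _ eXD eYD.
  have := sup _ _ XD eYD; have := sup _ _ eXD YD.
  rewrite setUCA -setUA.
  rewrite -setUIr -setUUr in h2.
  have -> : X :&: (e |: Y) = X :&: Y.
    by apply/setP=> z; rewrite !inE; case: eqP => // ->; rewrite (negPf eX).
  have -> : (e |: X) :&: Y = X :&: Y.
    by apply/setP=> z; rewrite !inE; case: eqP => // ->; rewrite (negPf eY) !andbF.
  lia.
- move=> X Y /up[XD eXD eX] /up[YD eYD eY].
  have h1 := sub _ _ XD YD; have h2 := sub _ _ eXD eYD.
  have := sub _ _ XD eYD; have := sub _ _ eXD YD.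
  rewrite setUCA -setUA.
  rewrite -setUIr -setUUr in h2.
  have -> : X :&: (e |: Y) = X :&: Y.
    by apply/setP=> z; rewrite !inE; case: eqP => // ->; rewrite (negPf eX).
  have -> : (e |: X) :&: Y = X :&: Y.
    by apply/setP=> z; rewrite !inE; case: eqP => // ->; rewrite (negPf eY) !andbF.
  lia.
- move=> X Y /up[XD eXD eX] /up[YD eYD eY].
  have h1 := cross _ _ XD YD; have h2 := cross _ _ eXD eYD.
  have h3 := cross _ _ XD eYD; have h4 := cross _ _ eXD YD.
  have E1 (U Z : {set A}) : e \notin U -> U :\: (e |: Z) = U :\: Z.
    move=> eU; apply/setP=> z; rewrite !inE; case: eqP => // ->.
    by rewrite (negPf eU) !andbF.
  have E2 (U Z : {set A}) : e \notin Z -> (e |: U) :\: Z = e |: (U :\: Z).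
    by move=> eU; apply/setP=> z; rewrite !inE; case: eqP => // ->; rewrite (negPf eU).
  have E3 (U Z : {set A}) : e \notin U -> (e |: U) :\: (e |: Z) = U :\: Z.
    by move=> eU; apply/setP=> z; rewrite !inE; case: eqP => // ->; rewrite (negPf eU) !andbF.
  rewrite !E3 // in h2; rewrite E1 // E2 // in h3; rewrite E2 // E1 // in h4.
  lia.
Qed.
End FixCoordinate.

(** Induction on [D]: one coordinate is fixed to an integer [t] that keeps the two sections
    compatible. All bounds on [t] are integers, so integrality is free once every lower bound is at
    most every upper bound. *)
Theorem strong_pair_intersection (A : finType) (D : {set A})
    (p1 q1 p2 q2 : {set A} -> int) :
  strong_pair D p1 q1 -> strong_pair D p2 q2 ->
  (forall X : {set A}, X \subset D -> p1 X <= q2 X /\ p2 X <= q1 X) ->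
  exists x : A -> int, forall X : {set A}, X \subset D ->
    (p1 X <= \sum_(a in X) x a <= q1 X) && (p2 X <= \sum_(a in X) x a <= q2 X).
Proof.
have [n] := ubnP #|D|; elim: n => // n IH in D p1 q1 p2 q2 *.
case: (set_0Vmem D) => [-> _|[e eD] ltn] s1 s2 le12.
  exists (fun=> 0) => X; rewrite subset0 => /eqP->.
  by rewrite big_set0 (sp_p0 s1) (sp_q0 s1) (sp_p0 s2) (sp_q0 s2).
pose R X := X :&: (D :\ e).
(* The bounds on [t] under which the sections still satisfy the hypothesis relating the two pairs:
   index [true] is for [p1] against [q2], index [false] for [p2] against [q1]. *)
pose lo (i : bool * {set A}) := if i.1 then p1 (e |: R i.2) - q2 (R i.2)
                                else p2 (e |: R i.2) - q1 (R i.2).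
pose up (i : bool * {set A}) := if i.1 then q2 (e |: R i.2) - p1 (R i.2)
                                else q1 (e |: R i.2) - p2 (R i.2).
have RP X : [/\ R X \subset D, e |: R X \subset D & e \notin R X].
  split; last by rewrite !inE eqxx andbF.
    exact: subset_trans (subsetIr _ _) (subsetDl _ _).
  rewrite subUset sub1set eD; exact: subset_trans (subsetIr _ _) (subsetDl _ _).
have RE (X : {set A}) : X \subset D :\ e -> R X = X by move/setIidPl.
(* Two bounds with the same index: [e |: R X] with [R Y] under [p], and [R X] with [e |: R Y] under
   [q], have the same intersection and the same union. *)
have same (p q : {set A} -> int) X Y : 
    (forall X Y : {set A}, X \subset D -> Y \subset D -> p X + p Y <= p (X :&: Y) + p (X :|: Y)) ->
    (forall X Y : {set A}, X \subset D -> Y \subset D -> q (X :&: Y) + q (X :|: Y) <= q X + q Y) ->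
    (forall X : {set A}, X \subset D -> p X <= q X) ->
    p (e |: R X) - q (R X) <= q (e |: R Y) - p (R Y).
  move=> sup sub pq; have [XD eXD eX] := RP X; have [YD eYD eY] := RP Y.
  have h1 := sup _ _ eXD YD; have h2 := sub _ _ XD eYD.
  have EI : R X :&: (e |: R Y) = (e |: R X) :&: R Y.
    apply/setP=> z; rewrite in_setI in_setU1 in_setI in_setU1.
    by case: eqP => // ->; rewrite (negPf eX) (negPf eY).
  rewrite EI setUCA in h2; rewrite -setUA in h1.
  have := pq ((e |: R X) :&: R Y); have := pq (e |: (R X :|: R Y)).
  rewrite -?setUA !subUset sub1set eD XD YD (subset_trans (subsetIr _ _) YD) /=.
  by move=> /(_ isT) h3 /(_ isT) h4; lia.
(* Two bounds with different indices: the cross inequalities of both pairs leave only the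
   differences of [R X] and [R Y], on which [pq] applies. *)
have cross (p q p' q' : {set A} -> int) X Y : strong_pair D p q -> strong_pair D p' q' ->
    (forall X : {set A}, X \subset D -> p X <= q' X /\ p' X <= q X) ->
    p (e |: R X) - q' (R X) <= q (e |: R Y) - p' (R Y).
  move=> s s' pq; have [XD eXD eX] := RP X; have [YD eYD eY] := RP Y.
  have h1 := sp_cross s eYD eXD; have h2 := sp_cross s' XD YD.
  have E3 (U Z : {set A}) : e \notin U -> (e |: U) :\: (e |: Z) = U :\: Z.
    by move=> eU; apply/setP=> z; rewrite !inE; case: eqP => // ->; rewrite (negPf eU) !andbF.
  rewrite !E3 // in h1.
  have [h3 _] := pq _ (subset_trans (subsetDl (R X) (R Y)) XD).
  have [_ h4] := pq _ (subset_trans (subsetDl (R Y) (R X)) YD).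
  lia.
have [t tP] : exists t, forall i, (lo i <= t) && (t <= up i).
  apply: (int_separation (true, set0)) => -[[] X] [[] Y]; rewrite /lo /up /=.
  - by apply: same => [||Z /le12[]//]; [exact: sp_super s1|exact: sp_sub s2].
  - exact: cross s1 s2 le12.
  - by apply: cross s2 s1 _ => Z /le12[].
  - by apply: same => [||Z /le12[]//]; [exact: sp_super s2|exact: sp_sub s1].
(* At the empty set the bounds on [t] place it between [p [set e]] and [q [set e]] for both
   pairs. *)
have R0 : R set0 = set0 by rewrite /R set0I.
have := tP (true, set0); have := tP (false, set0); rewrite /lo /up /= R0 setU0.
rewrite (sp_p0 s1) (sp_q0 s1) (sp_p0 s2) (sp_q0 s2) !subr0 => t2 t1.
have t11 : p1 [set e] <= t <= q1 [set e] by lia.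
have t22 : p2 [set e] <= t <= q2 [set e] by lia.
have lt' : (#|D :\ e| < n)%N by move: ltn; rewrite (cardsD1 e D) eD.
have [X XD|x xP] := IH _ _ _ _ _ lt' (strong_pair_section eD s1 t11) (strong_pair_section eD s2 t22).
  have := tP (true, X); have := tP (false, X); rewrite /lo /up /= RE //.
  have [RD eRD _] := RP X; rewrite RE // in RD eRD.
  have := le12 _ RD; have := le12 _ eRD; rewrite /sec_lo /sec_up; lia.
exists (fun a => if a == e then t else x a) => X XD.
have XD' : X :\ e \subset D :\ e by rewrite setSD.
have := xP _ XD'; rewrite /sec_lo /sec_up => h.
have sumE : \sum_(a in X :\ e) (if a == e then t else x a) = \sum_(a in X :\ e) x a.
  by apply: eq_bigr => a; rewrite !inE => /andP[/negPf->].
case: (boolP (e \in X)) => eX.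
  by rewrite (big_setD1 e) //= eqxx sumE; rewrite setD1K // in h; lia.
have XE : X :\ e = X by apply/setDidPl; rewrite disjoint_sym disjoints1.
by rewrite XE in h sumE; rewrite sumE; lia.
Qed.

Local Close Scope ring_scope.

(** * Matroids from intersecting supermodular functions *)

Section Matroid.
Variables (A : finType) (indep : pred {set A}).
Hypothesis indep0 : indep set0.
Hypothesis indepS : forall I J : {set A}, I \subset J -> indep J -> indep I.
Hypothesis indep_augment : forall I J : {set A}, indep I -> indep J -> #|I| < #|J| ->
  exists2 e, e \in J :\: I & indep (e |: I).

Definition rank (Z : {set A}) := \max_(J : {set A} | indep J && (J \subset Z)) #|J|.

Lemma card_le_rank (J Z : {set A}) : indep J -> J \subset Z -> #|J| <= rank Z.
Proof. by move=> iJ JZ; apply: (@leq_bigmax_cond _ _ (fun J : {set A} => #|J|)); rewrite iJ. Qed.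

Lemma rank_le_card (Z : {set A}) : rank Z <= #|Z|.
Proof. by apply/bigmax_leqP => J /andP[_ /subset_leq_card]. Qed.

Lemma basis_exists (J Z : {set A}) : indep J -> J \subset Z ->
  exists B : {set A}, [/\ indep B, J \subset B, B \subset Z & #|B| = rank Z].
Proof.
move=> iJ JZ; have [B /maxsetP[/andP[iB BZ] Bmax] JB] :=
  @maxset_exists _ [pred B : {set A} | indep B && (B \subset Z)] J (introT andP (conj iJ JZ)).
exists B; split=> //; apply/eqP; rewrite eqn_leq card_le_rank //=.
apply/bigmax_leqP => B' /andP[iB' B'Z]; rewrite leqNgt; apply/negP => lt.
have [e] := indep_augment iB iB' lt; rewrite inE => /andP[eB eB'] ieB.
have := Bmax (e |: B); rewrite /= ieB subUset sub1set (subsetP B'Z) // BZ subsetUr.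
by move=> /(_ isT isT) E; rewrite -E setU11 in eB.
Qed.

Lemma indep_rank (J : {set A}) : #|J| <= rank J -> indep J.
Proof.
have [B [iB _ BJ <-]] := basis_exists indep0 (sub0set J).
by move=> le; have -> : J = B by apply/eqP; rewrite eq_sym eqEcard BJ.
Qed.

(** A basis [B] of the intersection extends to a basis [C] of the union; the traces of [C] on [X]
    and [Y] are independent and share all of [B]. *)
Lemma rank_submod (X Y : {set A}) : rank (X :&: Y) + rank (X :|: Y) <= rank X + rank Y.
Proof.
have [B [iB _ BI <-]] := basis_exists indep0 (sub0set (X :&: Y)).
have BU : B \subset X :|: Y by rewrite (subset_trans BI) // subIset // subsetUl.
have [C [iC BC CU <-]] := basis_exists iB BU.
have CX := card_le_rank (indepS (subsetIl C X) iC) (subsetIr C X).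
have CY := card_le_rank (indepS (subsetIl C Y) iC) (subsetIr C Y).
apply: leq_trans (leq_add CX CY); rewrite -[leqRHS]cardsUI -setIUr setIACA setIid.
rewrite (setIidPl CU) addnC leq_add2l; apply: subset_leq_card.
by rewrite subsetI BC.
Qed.
End Matroid.

(** * Counting elements by their image *)

Definition fiber (A W : finType) (h : A -> W) (J : {set A}) (X : {set W}) :=
  [set a in J | h a \in X].

Section Fiber.
Variables (A W : finType) (h : A -> W).
Implicit Types (J : {set A}) (X Y : {set W}).
Local Notation fib := (fiber h).

Lemma fiberUI J X Y : #|fib J X| + #|fib J Y| = #|fib J (X :&: Y)| + #|fib J (X :|: Y)|.
Proof.
rewrite -cardsUI addnC; congr (_ + _); apply: eq_card => a; rewrite !inE;
by case: (a \in J).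
Qed.

Lemma fiber_split J X Y : #|fib J X| = #|fib J (X :&: Y)| + #|fib J (X :\: Y)|.
Proof.
rewrite -(cardsID [set a | h a \in Y]); congr (_ + _); apply: eq_card => a; rewrite !inE.
  by rewrite andbA.
by rewrite andbCA.
Qed.

Lemma fiberSS J J' X Y : J \subset J' -> X \subset Y -> fib J X \subset fib J' Y.
Proof.
move=> JJ XY; apply/subsetP=> a; rewrite !inE => /andP[aJ aX].
by rewrite (subsetP JJ) // (subsetP XY).
Qed.

Lemma fiber_sum J X : #|fib J X| = \sum_(w in X) #|fib J [set w]|.
Proof.
rewrite -sum1_card (partition_big h (mem X)) /=; last by move=> a; rewrite inE => /andP[].
apply: eq_bigr => w wX; rewrite -sum1_card; apply: eq_bigl => a.
by rewrite !inE; case: eqP => [->|_]; rewrite ?wX ?andbT ?andbF.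
Qed.

Lemma fiberU1 J X e : e \notin J -> #|fib (e |: J) X| = (h e \in X) + #|fib J X|.
Proof.
move=> eJ; case: (boolP (h e \in X)) => eX /=.
  have -> : fib (e |: J) X = e |: fib J X.
    by apply/setP=> a; rewrite !inE; case: eqP => // ->; rewrite eX.
  by rewrite cardsU1 !inE (negPf eJ).
rewrite add0n; apply: eq_card => a; rewrite !inE.
by case: eqP => // ->; rewrite (negPf eX) !andbF.
Qed.
End Fiber.

Definition int_super (W : finType) (F : pred {set W}) (g : {set W} -> int) :=
  forall X Y, F X -> F Y -> X :&: Y != set0 ->
    [/\ F (X :&: Y), F (X :|: Y) & (g X + g Y <= g (X :&: Y) + g (X :|: Y))%R].

Section OneSide.
Variables (A W : finType) (F : pred {set W}) (h : A -> W).
Variables (D : {set A}) (k : nat) (g : {set W} -> int).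
Hypothesis g_super : int_super F g.
Hypothesis g_le_k : forall X, F X -> (g X <= k%:Z)%R.
Hypothesis g_le_D : forall X, F X -> (g X <= #|fiber h D X|%:Z)%R.
Local Notation fib := (fiber h).

(** For [J \subset D]: removing [J] as a single colour class leaves at least [g X - 1] elements of
    [D] over every [X]. These are the independent sets of a matroid. *)
Definition sparse (J : {set A}) :=
  [forall X, F X ==> (#|fib J X|%:Z + g X <= #|fib D X|%:Z + 1)%R].

Lemma sparseP J : reflect (forall X, F X -> (#|fib J X|%:Z + g X <= #|fib D X|%:Z + 1)%R) (sparse J).
Proof.
apply: (iffP forallP) => [H X FX|H X]; first by move/implyP: (H X); apply.
by apply/implyP/H.
Qed.

Lemma sparse0 : sparse set0.
Proof.
apply/sparseP => X FX; have -> : fib set0 X = set0 by apply/setP=> a; rewrite !inE.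
rewrite cards0; have := g_le_D FX; lia.
Qed.

Lemma sparseS (I J : {set A}) : I \subset J -> sparse J -> sparse I.
Proof.
move=> IJ /sparseP H; apply/sparseP => X FX; have := H X FX.
have := subset_leq_card (fiberSS h IJ (subxx X)); lia.
Qed.

Definition tight (I : {set A}) :=
  [pred X | F X && (#|fib I X|%:Z + g X == #|fib D X|%:Z + 1)%R].

Lemma tightU I X Y : sparse I -> tight I X -> tight I Y -> X :&: Y != set0 ->
  tight I (X :|: Y).
Proof.
move=> /sparseP sI /andP[FX /eqP tX] /andP[FY /eqP tY] XY.
have [FI FU le] := g_super FX FY XY.
rewrite /= FU; have := sI _ FI; have := sI _ FU.
have := fiberUI h I X Y; have := fiberUI h D X Y; lia.
Qed.

Lemma not_sparseU1 I e : sparse I -> e \notin I -> ~~ sparse (e |: I) ->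
  exists2 X, tight I X & h e \in X.
Proof.
move=> /sparseP sI eI; rewrite negb_forall => /existsP[X]; rewrite negb_imply => /andP[FX].
rewrite fiberU1 // => H; exists X; last by apply: contraNT H => /negPf->; exact: sI.
rewrite /= FX; have := sI X FX; move: H; case: (h e \in X) => /=; lia.
Qed.

(* The maximal tight sets are pairwise disjoint. *)
Lemma card_le_tight_cover I Z c : 0 < c -> sparse I ->
  (forall e, e \in Z :\: I -> exists2 X, tight I X & h e \in X) ->
  (forall X, tight I X -> #|fib Z X| <= c * #|fib I X|) ->
  #|Z| <= c * #|I|.
Proof.
move=> c0 sI cov le; pose T := [set X | maxset (tight I) X].
have tT X : X \in T -> tight I X by rewrite inE => /maxsetP[].
have trT : trivIset T.
  apply/trivIsetP => X Y XT YT; apply: contraR; rewrite -setI_eq0 => XY.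
  have tU := tightU sI (tT _ XT) (tT _ YT) XY.
  move: XT YT; rewrite !inE => /maxsetP[_ mX] /maxsetP[_ mY].
  by rewrite -(mX _ tU (subsetUl _ _)) [eqbRHS](esym (mY _ tU (subsetUr _ _))).
have full (J : {set A}) : #|J| = \sum_w #|fib J [set w]|.
  transitivity #|fib J setT|; last by rewrite fiber_sum; apply: eq_bigl => w; rewrite inE.
  by apply: eq_card => a; rewrite !inE andbT.
(* Elements over the maximal tight sets are compared set by set; elements of [Z] elsewhere already
   belong to [I]. *)
rewrite !full big_distrr /= (bigID (mem (cover T))) [leqRHS](bigID (mem (cover T))) /=.
apply: leq_add.
  rewrite !big_trivIset //=; apply: leq_sum => X XT; rewrite -big_distrr -!fiber_sum.
  exact/le/tT.
apply: leq_sum => w wT; apply: leq_trans (leq_pmull _ c0); apply: subset_leq_card.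
apply/subsetP => e; rewrite !inE => /andP[eZ /eqP ew]; rewrite ew eqxx andbT.
apply: contraR wT => eI; have [|X tX eX] := cov e; first by rewrite inE eI.
have [Y mY XY] := maxset_exists tX; apply/bigcupP; exists Y; first by rewrite inE.
by rewrite -ew (subsetP XY).
Qed.

(** If no element of [J] could be added, tight sets would cover [J :\: I]. Over a tight set [I] is
    as large as sparsity allows, hence at least as large as [J], and so [#|J| <= #|I|]. *)
Lemma sparse_augment (I J : {set A}) : sparse I -> sparse J -> #|I| < #|J| ->
  exists2 e, e \in J :\: I & sparse (e |: I).
Proof.
move=> sI sJ lt; apply/exists_inP/negbNE; rewrite negb_exists_in.
apply/negP => /forall_inP H; move: lt; rewrite ltnNge => /negP; apply.
rewrite -(mul1n #|I|); apply: card_le_tight_cover => // [e eJI|X /andP[FX /eqP tX]].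
  by apply: not_sparseU1 (H e eJI) => //; move: eJI; rewrite inE => /andP[].
rewrite mul1n; move/sparseP: sJ => /(_ X FX); lia.
Qed.

Definition srank := rank sparse.

(** The upper bound for the fractional point [1/k]. Over a set tight for a basis, with [m] elements
    of [D], the basis has [m - g + 1] elements, and [k (m - g + 1) - m = (k - 1)(m - g) + (k - g)]
    is nonnegative. *)
Lemma srank_lower (Z : {set A}) : 0 < k -> Z \subset D -> #|Z| <= k * srank Z.
Proof.
move=> k_gt0 ZD; have [B [sB _ BZ rB]] := basis_exists sparse_augment sparse0 (sub0set Z).
rewrite /srank -rB; apply: card_le_tight_cover => // [e|X /andP[FX /eqP tX]].
  rewrite inE => /andP[eB eZ]; apply: not_sparseU1 => //; apply/negP => sU.
  have := card_le_rank sU; move=> /(_ Z); rewrite subUset sub1set eZ BZ -rB cardsU1 eB.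
  by rewrite ltnn => /(_ isT).
have ZX := subset_leq_card (fiberSS h ZD (subxx X)).
apply: leq_trans ZX _; have := g_le_k FX; have := g_le_D FX.
move: tX k_gt0; move: #|_| #|_| (g X) => a b c; nia.
Qed.

(** Sets demanding all [k] colours must be met by every class. Taking only the minimal ones makes
    them disjoint, so that they can be counted. *)
Definition full_sets := [set Y | minset [pred Y | F Y && (g Y == k%:Z%R)] Y].
Definition full_inside (Z : {set A}) := [set Y in full_sets | fib D Y \subset Z].

Lemma full_setsP Y : Y \in full_sets -> F Y /\ g Y = k%:Z%R.
Proof. by rewrite inE => /minsetP[/andP[? /eqP]]. Qed.

(** Supermodularity and the bound [k] force the value [k] on the intersection as well, against
    minimality. *)
Lemma full_sets_disjoint X Y : X \in full_sets -> Y \in full_sets ->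
  X :&: Y != set0 -> X = Y.
Proof.
move=> Xf Yf XY; have [FX gX] := full_setsP Xf; have [FY gY] := full_setsP Yf.
have [FI FU le] := g_super FX FY XY; have := g_le_k FI; have := g_le_k FU => lU lI.
have pI : [pred Y | F Y && (g Y == k%:Z%R)] (X :&: Y) by rewrite /= FI; lia.
move: Xf Yf; rewrite !inE => /minsetP[_ mX] /minsetP[_ mY].
by rewrite -(mX _ pI (subsetIl _ _)) [RHS](esym (mY _ pI (subsetIr _ _))).
Qed.

Lemma full_inside_super X Y :
  #|full_inside X| + #|full_inside Y| <= #|full_inside (X :&: Y)| + #|full_inside (X :|: Y)|.
Proof.
rewrite -cardsUI addnC leq_add //; apply: subset_leq_card.
  by apply/subsetP=> Z; rewrite !inE subsetI => /andP[/andP[-> ->] /andP[_ ->]].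
apply/subsetP=> Z; rewrite !inE => /orP[] /andP[-> H] /=.
  exact: subset_trans H (subsetUl _ _).
exact: subset_trans H (subsetUr _ _).
Qed.

(** The lower bound for the point [1/k]: full sets are disjoint and each has at least [k] elements
    of [D] over it. *)
Lemma full_inside_mul (Z : {set A}) : Z \subset D -> k * #|full_inside Z| <= #|Z|.
Proof.
move=> ZD; rewrite mulnC.
have tr : trivIset (full_inside Z).
  apply/trivIsetP => X Y; rewrite ![_ \in full_inside _]inE => /andP[Xf _] /andP[Yf _]; apply: contraR.
  by rewrite -setI_eq0 => /(full_sets_disjoint Xf Yf)->.
have leZ : #|fib Z (cover (full_inside Z))| <= #|Z|.
  by apply: subset_leq_card; apply/subsetP=> a; rewrite inE => /andP[].
apply: leq_trans leZ; rewrite fiber_sum big_trivIset //= -sum_nat_const.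
apply: leq_sum => Y; rewrite inE => /andP[Yf YZ]; rewrite -fiber_sum.
have [FY gY] := full_setsP Yf; have := g_le_D FY; rewrite gY lez_nat => kD.
apply: leq_trans kD (subset_leq_card _); apply/subsetP=> a aY.
by rewrite inE (subsetP YZ) //=; move: aY; rewrite inE => /andP[].
Qed.

Lemma cross_arith (b1 b2 d1 d2 : nat) (gU gI gV l : int) :
  (gU + l <= gI + gV)%R -> b1 <= 1 -> b2 <= d2 -> (gI <= d1%:Z)%R -> (gV <= l)%R ->
  ((b1 + b2)%N%:Z + gU <= (d1 + d2)%N%:Z + 1)%R.
Proof. lia. Qed.

(* One arc from each full set inside [Y] that meets [X] can be added to a basis of [X :\: Y]. *)
Lemma srank_cross (X Y : {set A}) : X \subset D -> Y \subset D ->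
  srank (X :\: Y) + #|full_inside Y| <= srank X + #|full_inside (Y :\: X)|.
Proof.
move=> XD YD; pose sel := full_inside Y :\: full_inside (Y :\: X).
have -> : #|full_inside Y| = #|sel| + #|full_inside (Y :\: X)|.
  rewrite addnC -(cardsID (full_inside (Y :\: X)) (full_inside Y)); congr (_ + _).
  apply: eq_card => Z; rewrite !inE; case: (minset _ _) => //=.
  by apply: andb_idl => H; apply: subset_trans H (subsetDl _ _).
rewrite addnA leq_add2r.
have selP Z : Z \in sel -> [/\ Z \in full_sets, fib D Z \subset Y &
    exists2 e, e \in fib D Z & e \in X].
  rewrite in_setD ![Z \in full_inside _]inE => /andP[]; case Zf: (Z \in full_sets) => //= nZ ZY.
  split=> //.
  case/subsetPn: nZ => e eZ; rewrite inE negb_and negbK (subsetP ZY) // orbF.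
  by exists e.
have [B [sB _ BZ rB]] := basis_exists sparse_augment sparse0 (sub0set (X :\: Y)).
rewrite /srank -rB.
case: (set_0Vmem sel) => [->|[Y0 /selP[_ _ [e0 _ _]]]].
  by rewrite cards0 addn0; apply: card_le_rank => //; apply: subset_trans BZ (subsetDl _ _).
pose f (Z : {set W}) := odflt e0 [pick e in fib D Z :&: X].
have fP Z : Z \in sel -> f Z \in fib D Z /\ f Z \in X.
  move=> /selP[_ _ [e eZ eX]]; rewrite /f; case: pickP => [a|/(_ e)] /=.
    by rewrite inE => /andP[].
  by rewrite inE eZ eX.
have finj : {in sel &, injective f}.
  move=> Z1 Z2 s1 s2 E; have [f1 _] := fP _ s1; have [f2 _] := fP _ s2.
  have [Zf1 _ _] := selP _ s1; have [Zf2 _ _] := selP _ s2.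
  apply: full_sets_disjoint => //; apply/set0Pn; exists (h (f Z1)).
  by move: f1 f2; rewrite E !inE => /andP[_ ->] /andP[_ ->].
have BX : B \subset X by apply: subset_trans BZ (subsetDl _ _).
have fX : f @: sel \subset X by apply/subsetP=> _ /imsetP[Z /fP[_ ?] ->].
have dis : B :&: f @: sel = set0.
  apply/eqP; rewrite setI_eq0 disjoint_subset; apply/subsetP=> e /(subsetP BZ).
  rewrite !inE => /andP[eY _]; apply: contra eY => /imsetP[Z Zs ->].
  by have [fZ _] := fP _ Zs; have [_ /subsetP ZY _] := selP _ Zs; apply: ZY.
have <- : #|B :|: f @: sel| = #|B| + #|sel|.
  by rewrite cardsU dis cards0 subn0 card_in_imset.
apply: card_le_rank; last by rewrite subUset BX fX.
apply/sparseP => U FU.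
(* If [U] meets a selected [Z], then [g Z = k] and uncrossing give [g U <= g (U :&: Z)], which the
   elements of [D] over [U :&: Z] bound. Over [Z] the new set contains only [f Z], since [B] avoids
   [Y]. *)
case: (boolP [exists Z in sel, U :&: Z != set0]) => [/exists_inP[Z Zs UZ]|].
  have [Zf ZY _] := selP _ Zs; have [FZ gZ] := full_setsP Zf.
  have [FI FUU le] := g_super FU FZ UZ.
  have := g_le_k FUU; have := g_le_D FI; rewrite (fiber_split h D U Z).
  rewrite (fiber_split h (B :|: _) U Z).
  have B'D : B :|: f @: sel \subset D by rewrite subUset !(subset_trans _ XD).
  have := subset_leq_card (fiberSS h B'D (subxx (U :\: Z))).
  have : #|fib (B :|: f @: sel) (U :&: Z)| <= 1.
    rewrite -(cards1 (f Z)); apply: subset_leq_card; apply/subsetP=> a.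
    rewrite 4!inE => /andP[aB /andP[_ aZ]]; apply/eqP.
    have aD : a \in D by apply: (subsetP B'D); rewrite inE.
    have aY : a \in Y by apply: (subsetP ZY); rewrite inE aD.
    case/orP: aB => [/(subsetP BZ)|/imsetP[Z' Z's E]]; first by rewrite inE aY.
    rewrite E; congr f; have [Zf' _ _] := selP _ Z's; apply: full_sets_disjoint => //.
    apply/set0Pn; exists (h a); rewrite inE aZ andbT.
    by have [] := fP _ Z's; rewrite -E inE aD.
  rewrite gZ in le; exact: cross_arith le.
(* Otherwise no chosen element lies over [U], and sparsity of [B] suffices. *)
rewrite negb_exists_in => /forall_inP nU.
have -> : fib (B :|: f @: sel) U = fib B U; last exact: (sparseP _ sB).
apply/setP=> a; rewrite !inE; case aU: (h a \in U); rewrite ?andbF ?andbT //.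
apply: orb_idr => /imsetP[Z Zs E]; have := nU Z Zs; rewrite negbK => /eqP/setP/(_ (h a)).
by have [] := fP _ Zs; rewrite -E !inE aU => /andP[_ ->].
Qed.
End OneSide.

(** * Supermodular colouring *)

Section Selection.
Variables (A W : finType) (F : pred {set W}) (h : A -> W).
Variables (D : {set A}) (k : nat) (g : {set W} -> int).
Hypothesis g_super : int_super F g.
Hypothesis g_le_k : forall X, F X -> (g X <= k%:Z)%R.
Hypothesis g_le_D : forall X, F X -> (g X <= #|fiber h D X|%:Z)%R.
Local Notation fib := (fiber h).
Local Notation full := (full_inside F h D k g).
Local Notation rk := (srank F h D g).

Lemma strong_pair_full_srank : 0 < k -> strong_pair D (fun Z => #|full Z|%:Z)%R (fun Z => (rk Z)%:Z)%R.
Proof.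
move=> k_gt0; split.
- have := full_inside_mul g_super g_le_k g_le_D (sub0set D); rewrite cards0.
  by move: #|_| k_gt0 => n; nia.
- by have := rank_le_card (sparse F h D g) set0; rewrite cards0 leqn0 => /eqP; rewrite /srank => ->.
- by move=> X Y _ _; have := full_inside_super F h D k g X Y; rewrite -!PoszD lez_nat.
- move=> X Y _ _.
  have := rank_submod (sparse0 g_le_D) (@sparseS _ _ F h D g)
    (sparse_augment g_super) X Y.
  rewrite /srank; lia.
- by move=> X Y XD YD; have := srank_cross g_super g_le_k g_le_D XD YD; lia.
Qed.

(** Passing from [k] to [k.-1] colours. The upper bound at [Z = J] makes [J] sparse, so enough
    elements remain; the lower bound at the elements over a full set makes [J] meet it, so a set
    missed by [J] demands fewer than [k] colours. *)
Lemma selection (J : {set A}) : J \subset D ->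
  (forall Z : {set A}, Z \subset D -> #|full Z| <= #|Z :&: J| <= rk Z) ->
  forall X, F X -> (g X - (fib J X != set0)%:Z <= k.-1%:Z)%R /\
    (g X - (fib J X != set0)%:Z <= #|fib (D :\: J) X|%:Z)%R.
Proof.
move=> JD JP X FX.
have /sparseP sJ : sparse F h D g J.
  apply: (indep_rank (sparse0 g_le_D) (sparse_augment g_super)).
  by have := JP J JD; rewrite setIid => /andP[].
have fibD : #|fib D X| = #|fib J X| + #|fib (D :\: J) X|.
  rewrite -(cardsID J (fib D X)); congr (_ + _); apply: eq_card => a; rewrite !inE.
    by case aJ: (a \in J); rewrite ?andbF // (subsetP JD) // andbT.
  by rewrite andbA.
have := sJ X FX; have := g_le_D FX; have := g_le_k FX; rewrite fibD.
case: (eqVneq (fib J X) set0) => [J0|_] /=; last by lia.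
rewrite J0 cards0 => lk lD _; split; last by lia.
suff : g X <> k%:Z%R by lia.
move=> gX; have [Y Ymin YX] :=
  @minset_exists _ [pred Y | F Y && (g Y == k%:Z)%R] X (introT andP (conj FX (introT eqP gX))).
have Yf : Y \in full_sets F k g by rewrite inE.
have DY : fib D Y \subset D by apply/subsetP=> a; rewrite inE => /andP[].
have /andP[+ _] := JP _ DY; rewrite leqNgt => /negP; apply.
have -> : fib D Y :&: J = set0.
  apply/setP=> a; rewrite !inE; apply/negP => /andP[/andP[_ aY] aJ].
  by move/setP/(_ a): J0; rewrite !inE aJ (subsetP YX).
by rewrite cards0; apply/card_gt0P; exists Y; rewrite inE Yf subxx.
Qed.
End Selection.

Definition color_class (A : finType) (c : A -> option nat) j := [set a | c a == Some j].

(** Being met by [J] is a submodular indicator: if the intersection is met then so are both sets,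
    and a met union has a met part. *)
Lemma int_super_sub_meets (A W : finType) (F : pred {set W}) (h : A -> W) (g : {set W} -> int) J :
  int_super F g -> int_super F (fun X => g X - (fiber h J X != set0)%:Z)%R.
Proof.
move=> gs X Y FX FY XY; have [FI FU le] := gs X Y FX FY XY; split=> //.
have hI (Z : {set W}) : fiber h J (X :&: Y) != set0 -> (X :&: Y) \subset Z -> fiber h J Z != set0.
  move=> H XYZ; apply: contraNneq H => Z0; rewrite -subset0 -Z0; exact: fiberSS.
have := fun H => hI X H (subsetIl X Y); have := fun H => hI Y H (subsetIr X Y).
have hU : fiber h J (X :|: Y) != set0 -> (fiber h J X != set0) || (fiber h J Y != set0).
  case/set0Pn=> a; rewrite !inE => /andP[aJ /orP[]] H; apply/orP; [left|right];
  by apply/set0Pn; exists a; rewrite inE aJ.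
move: hU le; case: (fiber h J (X :&: Y) != set0); case: (fiber h J (X :|: Y) != set0);
case: (fiber h J X != set0); case: (fiber h J Y != set0) => /= H1 le H2 H3;
first [by have := H1 isT|by have := H2 isT|by have := H3 isT|lia].
Qed.

Theorem supermodular_coloring (A W1 W2 : finType) (F1 : pred {set W1}) (F2 : pred {set W2})
    (h1 : A -> W1) (h2 : A -> W2) (k : nat) (D : {set A}) g1 g2 :
  int_super F1 g1 -> int_super F2 g2 ->
  (forall X, F1 X -> (g1 X <= k%:Z)%R /\ (g1 X <= #|fiber h1 D X|%:Z)%R) ->
  (forall X, F2 X -> (g2 X <= k%:Z)%R /\ (g2 X <= #|fiber h2 D X|%:Z)%R) ->
  exists c : A -> option nat, [/\
    forall a j, c a = Some j -> a \in D /\ j < k,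
    forall X, F1 X -> (g1 X <= (\sum_(j < k) (fiber h1 (color_class c j) X != set0))%:Z)%R &
    forall X, F2 X -> (g2 X <= (\sum_(j < k) (fiber h2 (color_class c j) X != set0))%:Z)%R].
Proof.
elim: k D g1 g2 => [|k IH] D g1 g2 s1 s2 b1 b2.
  by exists (fun=> None); split=> // X FX; rewrite big_ord0; [have [] := b1 X FX|have [] := b2 X FX].
have b1k X FX := (b1 X FX).1; have b1D X FX := (b1 X FX).2.
have b2k X FX := (b2 X FX).1; have b2D X FX := (b2 X FX).2.
have k0 := ltn0Sn k.
have [x xP] : exists x : A -> int, forall Z : {set A}, Z \subset D ->
    ((#|full_inside F1 h1 D k.+1 g1 Z|%:Z <= \sum_(a in Z) x a <= (srank F1 h1 D g1 Z)%:Z) &&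
     (#|full_inside F2 h2 D k.+1 g2 Z|%:Z <= \sum_(a in Z) x a <= (srank F2 h2 D g2 Z)%:Z))%R.
  apply: strong_pair_intersection (strong_pair_full_srank s1 b1k b1D k0)
    (strong_pair_full_srank s2 b2k b2D k0) _ => Z ZD.
  have m1 := full_inside_mul s1 b1k b1D ZD; have m2 := full_inside_mul s2 b2k b2D ZD.
  have r1 := srank_lower s1 b1k b1D k0 ZD; have r2 := srank_lower s2 b2k b2D k0 ZD.
  have l12 := leq_trans m1 r2; have l21 := leq_trans m2 r1.
  by split; rewrite lez_nat -(leq_pmul2l k0).
(* A singleton has rank at most 1 and a nonnegative lower bound, so [x] is the indicator of a class
   [J], which receives the new colour [k]. *)
have x01 a : a \in D -> x a = 0%R \/ x a = 1%R.
  move=> aD; have := xP [set a]; rewrite sub1set aD big_set1 => /(_ isT) /andP[/andP[lo up] _].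
  have := rank_le_card (sparse F1 h1 D g1) [set a]; rewrite cards1.
  move: lo up; rewrite /srank; lia.
pose J := [set a in D | x a == 1%R].
have JD : J \subset D by apply/subsetP=> a; rewrite inE => /andP[].
have sumJ (Z : {set A}) : Z \subset D -> (\sum_(a in Z) x a = #|Z :&: J|%:Z)%R.
  move=> ZD; rewrite (big_setID J) /= [X in (_ + X)%R]big1 ?addr0.
    rewrite (eq_bigr (fun=> 1%R)) ?sumr_const ?natz // => a.
    by rewrite !inE => /andP[_ /andP[_ /eqP]].
  move=> a; rewrite !inE => /andP[aJ /(subsetP ZD) aD].
  by case: (x01 a aD) => // x1; rewrite aD x1 eqxx in aJ.
have J1 (Z : {set A}) : Z \subset D ->
    #|full_inside F1 h1 D k.+1 g1 Z| <= #|Z :&: J| <= srank F1 h1 D g1 Z.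
  by move=> ZD; have := xP Z ZD; rewrite sumJ // !lez_nat => /andP[].
have J2 (Z : {set A}) : Z \subset D ->
    #|full_inside F2 h2 D k.+1 g2 Z| <= #|Z :&: J| <= srank F2 h2 D g2 Z.
  by move=> ZD; have := xP Z ZD; rewrite sumJ // !lez_nat => /andP[].
have [c' [dom c1 c2]] := IH (D :\: J) _ _ (int_super_sub_meets h1 J s1) (int_super_sub_meets h2 J s2)
  (selection s1 b1k b1D JD J1) (selection s2 b2k b2D JD J2).
pose c a := if a \in J then Some k else c' a.
have ck : color_class c k = J.
  apply/setP=> a; rewrite inE /c; case: (a \in J); first by rewrite eqxx.
  by apply/negP => /eqP/dom[_]; rewrite ltnn.
have cj (j : 'I_k) : color_class c j = color_class c' j.
  apply/setP=> a; rewrite !inE /c; case: ifP => // aJ.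
  have -> : (Some k == Some (j : nat)) = false.
    by apply/negP => /eqP[kj]; have := ltn_ord j; rewrite -kj ltnn.
  by apply/esym/negP => /eqP/dom[]; rewrite inE aJ.
exists c; split.
- move=> a j; rewrite /c; case: ifP => [aJ [<-]|_ /dom[]]; first by rewrite (subsetP JD).
  by rewrite inE => /andP[_ ->] /ltnW.
- move=> X FX; rewrite big_ord_recr /= ck; under eq_bigr => j _ do rewrite cj.
  by have := c1 X FX; rewrite /= lerBlDr -PoszD.
- move=> X FX; rewrite big_ord_recr /= ck; under eq_bigr => j _ do rewrite cj.
  by have := c2 X FX; rewrite /= lerBlDr -PoszD.
Qed.

(** * Extending a colouring to a packing of kernels *)

Definition intersecting (W : finType) (F : pred {set W}) :=
  forall X Y, F X -> F Y -> X :&: Y != set0 -> F (X :&: Y) /\ F (X :|: Y).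

Lemma uncross_arith m1 m2 mi mu d1 d2 di du : di + du <= d1 + d2 -> m1 + m2 <= mi + mu ->
  mi <= di -> mu <= du -> m1 = d1 -> m2 = d2 -> mi = di /\ mi + mu = m1 + m2.
Proof. lia. Qed.

Section Extension.
Variables (W A : finType) (F : pred {set W}) (hd tl : A -> W) (I : {set A}) (k : nat).
Hypothesis F_int : intersecting F.

Definition enters (a : A) (X : {set W}) := (hd a \in X) && (tl a \notin X).
Definition hit (c : A -> option nat) (j : nat) (X : {set W}) :=
  [exists a, (c a == Some j) && enters a X].
Definition uncolored (c : A -> option nat) : {set A} := [set a in I | c a == None].
Definition indeg (J : {set A}) (X : {set W}) := \sum_(a in J) enters a X.
Definition missing (c : A -> option nat) (X : {set W}) := \sum_(j < k) ~~ hit c j X.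

(** The invariant of the extension: members missed by a colour contain no head of that colour, hence
    stay missed when intersected. This makes [missing] supermodular. *)
Definition clear (c : A -> option nat) := forall j a X,
  F X -> ~~ hit c j X -> c a = Some j -> hd a \notin X.

Lemma indeg_submod J X Y : indeg J (X :&: Y) + indeg J (X :|: Y) <= indeg J X + indeg J Y.
Proof.
rewrite /indeg -!big_split /=; apply: leq_sum => a _; rewrite /enters !inE.
by do 4!case: (_ \in _).
Qed.

Lemma hitP c j X : reflect (exists2 a, c a = Some j & enters a X) (hit c j X).
Proof.
apply: (iffP existsP) => [[a /andP[/eqP ca ea]]|[a ca ea]]; exists a => //.
by rewrite ca eqxx.
Qed.

Lemma hit_clearI c j X Y : clear c -> F X -> ~~ hit c j X -> ~~ hit c j (X :&: Y).
Proof.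
move=> cl FX nX; apply/hitP => -[a ca /andP[]]; rewrite inE => /andP[hX _] _.
by have := cl j a X FX nX ca; rewrite hX.
Qed.

Lemma hitU c j X Y : hit c j (X :|: Y) -> hit c j X || hit c j Y.
Proof.
case/hitP=> a ca; rewrite /enters !inE negb_or => /andP[/orP[h|h] /andP[tX tY]].
- by apply/orP; left; apply/hitP; exists a => //; rewrite /enters h.
- by apply/orP; right; apply/hitP; exists a => //; rewrite /enters h.
Qed.

Lemma missing_supermod_at c j X Y : clear c -> F X -> F Y ->
  ~~ hit c j X + ~~ hit c j Y <= ~~ hit c j (X :&: Y) + ~~ hit c j (X :|: Y).
Proof.
move=> cl FX FY.
have := @hitU c j X Y; have := @hit_clearI c j X Y cl FX; have := @hit_clearI c j Y X cl FY.
rewrite (setIC Y X); case: (hit c j X); case: (hit c j Y) => //=.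
- by move=> /(_ isT)->.
- by move=> _ /(_ isT)->.
- by move=> /(_ isT)-> _; case: (hit c j (X :|: Y)) => // /(_ isT).
Qed.

Lemma missing_supermod c X Y : clear c -> F X -> F Y ->
  missing c X + missing c Y <= missing c (X :&: Y) + missing c (X :|: Y).
Proof.
move=> cl FX FY; rewrite /missing -!big_split /=; apply: leq_sum => j _.
exact: missing_supermod_at.
Qed.

Definition recolor (c : A -> option nat) a i := fun a' => if a' == a then Some i else c a'.

Lemma hit_recolor c a i j X : c a = None ->
  hit (recolor c a i) j X = hit c j X || ((i == j) && enters a X).
Proof.
move=> ca; apply/hitP/orP => [[a']|[/hitP[a' ca' ea']|/andP[/eqP<- ea]]].
- rewrite /recolor; case: eqP => [-> [->] ->|_ ca' ea']; first by right; rewrite eqxx.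
  by left; apply/hitP; exists a'.
- by exists a' => //; rewrite /recolor; case: eqP => // aa; rewrite aa ca in ca'.
- by exists a => //; rewrite /recolor eqxx.
Qed.

(* The new arc must enter a maximal set [Y] missed by colour [i]: the missed sets
   meeting [Y] are then inside [Y], which keeps the colouring clear. *)
Lemma extend_one c i : i < k -> clear c ->
  (forall X, F X -> missing c X <= indeg (uncolored c) X) ->
  (exists2 X, F X & ~~ hit c i X) ->
  exists2 a, a \in uncolored c & clear (recolor c a i) /\
    (forall X, F X -> missing (recolor c a i) X <= indeg (uncolored (recolor c a i)) X).
Proof.
move=> ik cl cut [X0 FX0 nX0].
have [Y /maxsetP[/andP[FY nY] Ymax] _] :=
  @maxset_exists _ [pred X | F X && ~~ hit c i X] X0 (introT andP (conj FX0 nX0)).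
have inY X : F X -> ~~ hit c i X -> X :&: Y != set0 -> X \subset Y.
  move=> FX nX XY; have [_ FU] := F_int FX FY XY.
  rewrite -(Ymax (X :|: Y)) ?subsetUl ?subsetUr //= FU.
  by apply/negP => /hitU; rewrite (negPf nX) (negPf nY).
pose tight X := missing c X == indeg (uncolored c) X.
(* Giving [a] colour [i] uses up an arc entering [X]; if [i] missed [X], the number of missing
   colours drops too. Only a tight set already hit by [i] can violate the cut condition. *)
suff [a aI [ea noX]] : exists2 a, a \in uncolored c & enters a Y /\
    (forall X, F X -> tight X -> hit c i X -> ~~ enters a X).
  have ca : c a = None by move: aI; rewrite inE => /andP[_ /eqP].
  exists a => //; split.
    move=> j a' X FX; rewrite hit_recolor // negb_or => /andP[nX].
    rewrite /recolor; case: (eqVneq a' a) => [-> |_]; last by move=> _; exact: (cl j a' X FX nX).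
    move=> + [ij]; rewrite -ij in nX *; rewrite eqxx /=.
    apply: contra => haX; rewrite /enters haX /=.
    case/andP: ea => haY; apply: contra; apply/subsetP/inY => //.
    by apply/set0Pn; exists (hd a); rewrite inE haX.
  move=> X FX.
  have uncoloredE : indeg (uncolored c) X = enters a X + indeg (uncolored (recolor c a i)) X.
    rewrite /indeg (big_setD1 a) //=; congr (_ + _); apply: eq_bigl => a'.
    rewrite !inE /recolor; case: eqP => [->|_]; first by rewrite andbF.
    by [].
  have missE : missing c X = (~~ hit c i X && enters a X) + missing (recolor c a i) X.
    rewrite /missing (bigD1 (Ordinal ik)) //= [in RHS](bigD1 (Ordinal ik)) //=.
    rewrite hit_recolor // eqxx /= addnA; congr (_ + _).
      by case: hit; case: enters.
    apply: eq_bigr => j; rewrite hit_recolor // -val_eqE /= eq_sym => /negPf->.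
    by rewrite orbF.
  have := cut X FX; rewrite uncoloredE missE.
  case hX: (hit c i X) => /=; last by case: (enters a X).
  rewrite add0n; case eX: (enters a X) => //= h.
  rewrite -ltnS -add1n ltn_neqAle h andbT.
  apply/negP => /eqP E; suff tX : tight X by have := noX X FX tX hX; rewrite eX.
  by rewrite /tight uncoloredE missE hX eX /= add0n E.
(* If there is no such set, any uncoloured arc entering [Y] works, and one exists because [Y] misses
   [i]. Otherwise the arc is found inside a minimal dangerous set. *)
pose dangerous := [pred X | [&& F X, tight X, hit c i X & X :&: Y != set0]].
case: (pickP dangerous) => [X1 /= dX1|nod]; last first.
  have : 0 < indeg (uncolored c) Y.
    apply: leq_trans (cut Y FY); rewrite /missing (bigD1 (Ordinal ik)) //=.
    by rewrite (negPf nY).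
  rewrite lt0n sum_nat_eq0 negb_forall => /existsP[a]; rewrite negb_imply eqb0 negbK.
  case/andP=> aI ea; exists a => //; split=> // X FX tX hX.
  apply/negP => /andP[haX _]; have := nod X; rewrite /= FX tX hX /=.
  move/negbFE/eqP/setP/(_ (hd a)); rewrite !inE haX.
  by case/andP: ea => ->.
have [X /minsetP[/and4P[FX tX hX XY] Xmin] _] := @minset_exists _ dangerous X1 dX1.
have [FI FU] := F_int FX FY XY.
(* [X :&: Y] misses every colour that [X] misses, and [i] besides. Hence some uncoloured arc enters
   [X :&: Y] but not [X]; its tail lies in [X :\: Y], so it enters [Y]. *)
have lt : indeg (uncolored c) X < indeg (uncolored c) (X :&: Y).
  apply: leq_trans (cut _ FI); rewrite -(eqP tX) /missing.
  rewrite (bigD1 (Ordinal ik)) //= [in X in _ <= X](bigD1 (Ordinal ik)) //=.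
  have -> : ~~ hit c i (X :&: Y) by rewrite setIC hit_clearI.
  rewrite hX /= add0n add1n ltnS; apply: leq_sum => j _.
  have := @hit_clearI c j X Y cl FX.
  by case: (hit c j X) => // /(_ isT)->.
have [a aI] : exists2 a, a \in uncolored c & enters a (X :&: Y) && ~~ enters a X.
  apply/exists_inP/negbNE; rewrite negb_exists_in; apply/negP => /forall_inP h.
  have := lt; rewrite ltnNge => /negP; apply; apply: leq_sum => a aI.
  by have := h a aI; case: (enters a (X :&: Y)); case: (enters a X).
rewrite /enters !inE => /andP[/andP[/andP[haX haY]]].
rewrite haX /= negbK => + taX; rewrite taX /= => taY.
exists a => //; split; first by rewrite haY.
move=> Z FZ tZ hZ; apply/negP => /andP[haZ taZ].
have XZ : X :&: Z != set0 by apply/set0Pn; exists (hd a); rewrite inE haX.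
have [FXZ FXZU] := F_int FX FZ XZ.
have h1 := indeg_submod (uncolored c) X Z; have h2 := missing_supermod cl FX FZ.
have [e1 e2] := uncross_arith h1 h2 (cut _ FXZ) (cut _ FXZU) (eqP tX) (eqP tZ).
(* Were [X :&: Z] missed by [i], which hits both sets, supermodularity would be strict at colour
   [i]. So [X :&: Z] is dangerous, and minimality puts the tail of [a] in [Z], a contradiction. *)
have hXZ : hit c i (X :&: Z).
  rewrite -[hit _ _ _]negbK; apply/negP => nXZ.
  have : missing c X + missing c Z < missing c (X :&: Z) + missing c (X :|: Z).
    rewrite /missing -!big_split /= (bigD1 (Ordinal ik)) //=.
    rewrite [in X in _ < X](bigD1 (Ordinal ik)) //= hX hZ nXZ /= add0n -addnA ltnS.
    apply: leq_trans (leq_addl _ _); apply: leq_sum => j _.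
    exact: missing_supermod_at.
  by rewrite e2 ltnn.
have tXZ : tight (X :&: Z) by rewrite /tight e1.
have E : X :&: Z = X.
  apply: Xmin; last exact: subsetIl.
  rewrite /= FXZ tXZ hXZ; apply/set0Pn; exists (hd a); by rewrite !inE haX haZ.
by move: taX; rewrite -E inE (negPf taZ) andbF.
Qed.

(** While some colour misses a member, [extend_one] colours one more arc of [I]; the number of
    uncoloured arcs decreases. *)
Theorem kernel_extension c : clear c ->
  (forall X, F X -> missing c X <= indeg (uncolored c) X) ->
  exists c', [/\ forall a, c a != None -> c' a = c a,
    forall a, c' a != None -> c a = None -> a \in I &
    forall j X, j < k -> F X -> hit c' j X].
Proof.
have [n] := ubnP #|uncolored c|; elim: n => // n IH in c * => ltn cl cut.
case: (pickP [pred ij : 'I_k * {set W} | F ij.2 && ~~ hit c ij.1 ij.2]) => [[i X]|all]; last first.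
  exists c; split=> // [a|j X jk FX]; first by move=> + ca; rewrite ca.
  by have := all (Ordinal jk, X); rewrite /= FX => /negbFE.
case/andP=> /= FX nX.
have [|a aI [cl' cut']] := extend_one (ltn_ord i) cl cut; first by exists X.
have ca : c a = None by move: aI; rewrite inE => /andP[_ /eqP].
have lt' : #|uncolored (recolor c a i)| < n.
  rewrite -ltnS; apply: leq_trans ltn; rewrite ltnS; apply: proper_card; apply/properP; split.
    by apply/subsetP=> a'; rewrite !inE /recolor; case: (a' == a) => //; rewrite andbF.
  by exists a => //; rewrite !inE /recolor eqxx andbF.
have [c' [ext dom cov]] := IH _ lt' cl' cut'.
exists c'; split=> // a'.
  move=> ca'; have ne : a' != a by apply: contraNneq ca' => ->; rewrite ca.
  by rewrite ext /recolor (negPf ne).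
move=> c'a ca'; case: (eqVneq a' a) => [->|ne]; first by move: aI; rewrite inE => /andP[].
by apply: dom; rewrite // /recolor (negPf ne).
Qed.
End Extension.

(** * Splitting vertices into groups of arcs *)

Section SplitDigraph.
Variables (V A : finType) (tail head : A -> V) (T : {set V}) (b : V -> nat) (k : nat).

(* The arc [a] is given its own head [inr a]; a vertex [v] is thus split, and
   [group v j] is one of its [b v] copies. *)
Definition split_tail (a : A) : V + A := inl (tail a).
Definition split_head (a : A) : V + A := inr a.
Definition split_set (U : {set V}) : {set V + A} :=
  [set w | match w with inl v => v \in U | inr a => head a \in U end].
(** The arcs with a common head are listed and cut into consecutive blocks of length [k]; this is
    the number of the block. *)
Definition rho (a : A) := index a (enum [set a' | head a' == head a]) %/ k.
Definition group (v : V) (j : nat) : {set V + A} :=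
  [set w | if w is inr a then (head a == v) && (rho a == j) else false].
Definition kernel (X : {set V + A}) :=
  [exists U : {set V}, [&& U != set0, U \subset T & X == split_set U]] ||
  [exists v in T, [exists j : 'I_(b v), X == group v j]].

Definition boundary_arcs := [set a | (head a \in T) && (tail a \notin T)].
Definition inner_arcs := [set a | (head a \in T) && (tail a \in T)].

Lemma kernelP X : reflect
  ((exists U : {set V}, [/\ U != set0, U \subset T & X = split_set U]) \/
   (exists v j, [/\ v \in T, j < b v & X = group v j])) (kernel X).
Proof.
apply: (iffP orP) => [[/existsP[U /and3P[U0 UT /eqP->]]|/exists_inP[v vT /existsP[j /eqP->]]]|].
- by left; exists U.
- by right; exists v, j; split.
case=> [[U [U0 UT ->]]|[v [j [vT jb ->]]]]; [left|right].
  by apply/existsP; exists U; rewrite U0 UT eqxx.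
by apply/exists_inP; exists v => //; apply/existsP; exists (Ordinal jb); rewrite eqxx.
Qed.

Lemma group_meets_split_set v j U : group v j :&: split_set U != set0 ->
  group v j \subset split_set U.
Proof.
case/set0Pn=> -[w|a]; rewrite !inE //= => /andP[/andP[/eqP hv _] hU].
by apply/subsetP=> -[w'|a']; rewrite !inE //= => /andP[/eqP-> _]; rewrite -hv.
Qed.

(** Split sets combine as the underlying vertex sets do; a group is inside or disjoint from a split
    set, and two groups are equal or disjoint. *)
Lemma kernel_intersecting : intersecting kernel.
Proof.
move=> X Y KX KY; case/kernelP: (KX) => [[U [U0 UT EX]]|[v [j [vT jb EX]]]].
  case/kernelP: (KY) => [[U' [U0' UT' EY]]|[v' [j' [vT' jb' EY]]]] XY; last first.
    have sub : Y \subset X by rewrite EX EY group_meets_split_set // -EX -EY setIC.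
    by rewrite (setIidPr sub) (setUidPl sub).
  split; apply/kernelP; left.
    exists (U :&: U'); split; last by rewrite EX EY; apply/setP=> -[w|a]; rewrite !inE.
      case/set0Pn: XY => w; rewrite EX EY !inE => /andP[].
      case: w => [w|a] aU aU'; apply/set0Pn; [exists w|exists (head a)]; by rewrite inE aU.
    exact: subset_trans (subsetIl _ _) UT.
  exists (U :|: U'); split; last by rewrite EX EY; apply/setP=> -[w|a]; rewrite !inE.
    by apply: contraNneq U0 => E; rewrite -subset0 -E subsetUl.
  by rewrite subUset UT.
case/kernelP: (KY) => [[U' [U0' UT' EY]]|[v' [j' [vT' jb' EY]]]] XY.
  have sub : X \subset Y by rewrite EX EY group_meets_split_set // -EX -EY.
  by rewrite (setIidPl sub) (setUidPr sub).
suff -> : Y = X by rewrite setIid setUid.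
case/set0Pn: XY => w; rewrite EX EY !inE; case: w => // a.
by case/andP=> /andP[/eqP<- /eqP<-] /andP[/eqP<- /eqP<-].
Qed.

(** The function is the demand on the boundary: the colours that the inner arcs entering [X] are too
    few to supply. *)
Lemma kernel_super :
  int_super kernel (fun X => k%:Z - (indeg split_head split_tail inner_arcs X)%:Z)%R.
Proof.
move=> X Y KX KY XY; have [KI KU] := kernel_intersecting KX KY XY; split=> //.
have /= := indeg_submod split_head split_tail inner_arcs X Y.
move: (indeg _ _ _ X) (indeg _ _ _ Y) (indeg _ _ _ (X :&: Y)) (indeg _ _ _ (X :|: Y)).
lia.
Qed.

Lemma boundary_enters a X : kernel X -> a \in boundary_arcs ->
  enters split_head split_tail a X = (split_head a \in X).
Proof.
rewrite inE => KX /andP[_ aT]; rewrite /enters; apply: andb_idr => _.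
case/kernelP: KX => [[U [U0 UT ->]]|[v [j [vT jb ->]]]]; rewrite !inE //=.
by apply: contra aT => /(subsetP UT).
Qed.

(** Block [j] of the list ends at position [(j + 1) k], at most [k * b v], so the degree bound makes
    it complete. *)
Lemma card_group v j : k * b v <= din tail head setT v -> j < b v ->
  k <= #|[set a | (head a == v) && (rho a == j)]|.
Proof.
move=> le jb; pose s := enum [set a | head a == v].
have ss : size s = din tail head setT v.
  by rewrite -cardE; apply: eq_card => a; rewrite !inE.
have us : uniq s := enum_uniq _.
have sz : size (take k (drop (j * k) s)) = k.
  rewrite size_takel // size_drop ss leq_subRL; last first.
    by apply: leq_trans le; rewrite mulnC leq_mul2l (ltnW jb) orbT.
  by rewrite addnC -mulSn mulnC (leq_trans _ le) // leq_mul2l jb orbT.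
rewrite -{1}sz -(card_uniqP (take_uniq _ (drop_uniq _ us))).
apply: subset_leq_card; apply/subsetP=> a aS.
have := nth_index a aS; move: (aS); rewrite -index_mem sz => lt.
rewrite nth_take // nth_drop => E.
have ltd : j * k + index a (take k (drop (j * k) s)) < size s.
  move: (aS); rewrite -index_mem => /leq_trans h; rewrite -ltn_subRL -size_drop.
  by apply: h; rewrite size_take_min geq_minr.
have as_ : a \in s by rewrite -E mem_nth.
have hv : head a = v by move: as_; rewrite mem_enum inE => /eqP.
rewrite inE hv eqxx /= /rho hv -/s -{1}E index_uniq // divnMDl ?divn_small ?addn0 //.
exact: leq_ltn_trans lt.
Qed.

Hypothesis deg_ge : forall v, v \in T -> k * b v <= din tail head setT v.
Hypothesis cut_ge : forall U : {set V}, U != set0 -> U \subset T -> k <= #|delta_in tail head U|.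

(** An arc with head in [T] is boundary or inner according to its tail, so [k] such arcs entering
    [X] suffice: the cut supplies them for a split set, the block for a group. *)
Lemma kernel_cut X : kernel X ->
  k <= #|fiber split_head boundary_arcs X| + indeg split_head split_tail inner_arcs X.
Proof.
move=> KX.
have -> : indeg split_head split_tail inner_arcs X =
    #|[set a in inner_arcs | enters split_head split_tail a X]|.
  rewrite /indeg -sum1_card big_mkcond [RHS]big_mkcond; apply: eq_bigr => a _.
  by rewrite !inE; case: (_ && _); case: enters.
suff [C [kC CT CX]] : exists C : {set A}, [/\ k <= #|C|, {in C, forall a, head a \in T} &
    {in C, forall a, enters split_head split_tail a X}].
  apply: leq_trans kC _; apply: leq_trans (leq_of_leqif (leq_card_setU _ _)).
  apply: subset_leq_card; apply/subsetP=> a aC.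
  have := CX a aC; rewrite !inE (CT a aC) => eX; rewrite eX andbT.
  by case: (tail a \in T); rewrite ?orbT //=; case/andP: eX => ->.
case/kernelP: KX => [[U [U0 UT ->]]|[v [j [vT jb ->]]]].
  exists (delta_in tail head U); split; first exact: cut_ge.
    by move=> a; rewrite inE => /andP[/(subsetP UT)].
  by move=> a; rewrite inE /enters !inE.
exists [set a | (head a == v) && (rho a == j)]; split.
- exact: card_group (deg_ge vT) jb.
- by move=> a; rewrite inE => /andP[/eqP->].
- by move=> a; rewrite inE /enters /split_head /split_tail !inE /= andbT.
Qed.

Lemma kernel_bounds X : kernel X ->
  (k%:Z - (indeg split_head split_tail inner_arcs X)%:Z <= k%:Z)%R /\
  (k%:Z - (indeg split_head split_tail inner_arcs X)%:Z
     <= #|fiber split_head boundary_arcs X|%:Z)%R.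
Proof. move=> KX; have := kernel_cut KX; lia. Qed.

Lemma boundary_coloring_extends (c : A -> option nat) :
  (forall a j, c a = Some j -> a \in boundary_arcs /\ j < k) ->
  (forall X, kernel X -> (k%:Z - (indeg split_head split_tail inner_arcs X)%:Z <=
     (\sum_(j < k) (fiber split_head (color_class c j) X != set0))%:Z)%R) ->
  exists c' : A -> option nat, [/\ forall a, c a != None -> c' a = c a,
    forall a, c' a != None -> c a = None -> a \in inner_arcs,
    forall j (U : {set V}), j < k -> U != set0 -> U \subset T ->
      exists2 a, c' a = Some j & a \in delta_in tail head U &
    forall j v, j < k -> v \in T -> b v <= #|[set a | (c' a == Some j) && (head a == v)]|].
Proof.
move=> dom cov.
have hitE j X : kernel X ->
    hit split_head split_tail c j X = (fiber split_head (color_class c j) X != set0).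
  move=> KX; apply/hitP/set0Pn => -[a].
    by move=> ca; rewrite boundary_enters ?(dom _ _ ca).1 // => aX; exists a; rewrite !inE ca eqxx.
  rewrite !inE => /andP[/eqP ca aX]; exists a => //.
  by rewrite boundary_enters ?(dom _ _ ca).1.
(* Initially all coloured arcs start outside [T], so having the head in a member already means
   entering it. *)
have cl : clear kernel split_head split_tail c.
  move=> j a X KX nX ca; apply: contra nX => aX; apply/hitP; exists a => //.
  by rewrite boundary_enters // (dom _ _ ca).1.
have uncoloredE : uncolored inner_arcs c = inner_arcs.
  apply/setP=> a; rewrite inE; apply: andb_idr; case ca: (c a) => [j|//].
  by have [] := dom _ _ ca; rewrite !inE => /andP[_ /negPf->]; rewrite andbF.
have [X KX|c' [ext new cov']] := @kernel_extension _ _ _ split_head split_tail inner_arcs k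
    kernel_intersecting c cl.
  (* Hit and missed colours add up to [k], which turns the covering hypothesis into the cut
     condition. *)
  rewrite uncoloredE; have := cov X KX; rewrite /missing.
  under eq_bigr => j _ do rewrite -hitE //.
  have : \sum_(j < k) ~~ hit split_head split_tail c j X
       + \sum_(j < k) hit split_head split_tail c j X = k.
    rewrite -big_split /= -[RHS]card_ord -sum1_card; apply: eq_bigr => j _.
    by case: hit.
  by move: (\sum_(j < k) _) (\sum_(j < k) _) (indeg _ _ _ _) => x y z <-; lia.
exists c'; split=> // [j U jk U0 UT|j v jk vT].
  have /hitP[a ca] : hit split_head split_tail c' j (split_set U).
    by apply: cov' => //; apply/kernelP; left; exists U.
  by rewrite /enters !inE => aU; exists a; rewrite ?inE.
(* Colour [j] enters each of the [b v] groups at [v], so [rho] takes all values below [b v] on its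
   arcs with head [v]. *)
rewrite -[b v](size_iota 0) cardE -(size_map rho).
apply: uniq_leq_size (iota_uniq _ _) _ => i; rewrite mem_iota add0n => /andP[_ ib].
have /hitP[a ca] : hit split_head split_tail c' j (group v i).
  by apply: cov' => //; apply/kernelP; right; exists v, i.
rewrite /enters !inE andbT => /andP[hv /eqP<-]; apply: map_f.
by rewrite mem_enum inE ca eqxx.
Qed.
End SplitDigraph.

(** * Packing bibranchings *)

Lemma leq_bigminP (I : finType) (P : pred I) (F : I -> nat) n k : k <= n ->
  reflect (forall i, P i -> k <= F i) (k <= \big[minn/n]_(i | P i) F i).
Proof.
move=> kn; apply: (iffP idP) => [+ i Pi|le].
  move/leq_trans; apply.
  have : i \in index_enum I by rewrite mem_index_enum.
  elim: (index_enum I) => // j r IH; rewrite inE big_cons => /orP[/eqP<-|/IH le].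
    by rewrite Pi geq_minl.
  by case: (P j) => //; apply: leq_trans (geq_minr _ _) le.
by elim/big_ind: _ => // x y kx ky; rewrite leq_min kx.
Qed.

Section Digraph.
Variables (V A : finType) (tail head : A -> V).

Lemma reach_enters (B : {set A}) (U : {set V}) x y :
  reach tail head B x y -> x \notin U -> y \in U ->
  exists2 a, a \in B & a \in delta_in tail head U.
Proof.
case/connectP=> p; elim: p x => [|z p IH] x /=; first by move=> _ -> /negPf->.
case/andP=> /exists_inP[a aB /andP[/eqP ta /eqP ha]] pp ly xU yU.
case: (boolP (z \in U)) => zU; last exact: IH pp ly zU yU.
by exists a; rewrite // inE ha ta zU.
Qed.

Lemma disjoint_packing_card k (F : 'I_k -> {set A}) (C : {set A}) n :
  (forall i j, i != j -> [disjoint F i & F j]) -> (forall i, n <= #|F i :&: C|) ->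
  k * n <= #|C|.
Proof.
move=> dis le; have -> : k * n = \sum_(i < k) n by rewrite sum_nat_const card_ord.
apply: (@leq_trans (\sum_(i < k) #|F i :&: C|)); first by apply: leq_sum => i _; exact: le.
have <- : #|\bigcup_i (F i :&: C)| = \sum_i #|F i :&: C|.
  rewrite -!sum1_card partition_disjoint_bigcup /=.
    by apply: eq_bigr => i _; rewrite sum1_card.
  by move=> i j /dis; apply: disjointW; exact: subsetIl.
by apply: subset_leq_card; apply/bigcupsP => i _; apply: subsetIr.
Qed.

Variables (S T : {set V}) (b : V -> nat).
Hypothesis ST0 : S :&: T = set0.
Hypothesis STT : S :|: T = setT.
Hypothesis T0 : T != set0.
Hypothesis b_gt0 : forall v, 0 < b v.

Lemma in_S v : (v \in S) = (v \notin T).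
Proof.
move/setP/(_ v): ST0; move/setP/(_ v): STT; rewrite !inE.
by case: (v \in S); case: (v \in T).
Qed.

Lemma bibranching_covers_bicut B U : is_bibranching tail head S T b B -> bicut_set T U ->
  exists2 a, a \in B & a \in delta_in tail head U.
Proof.
case=> reachT reachS _ _ /orP[/andP[/set0Pn[v vU] UT]|/andP[TU]].
  have [s sS sv] := reachT v (subsetP UT v vU); apply: reach_enters sv _ vU.
  by apply: contraL sS => /(subsetP UT); rewrite in_S negbK.
rewrite -subTset => /subsetPn[u _ uU].
have uS : u \in S by rewrite in_S; apply: contra uU; apply: (subsetP TU).
by have [t tT ut] := reachS u uS; apply: reach_enters ut uU (subsetP TU t tT).
Qed.

Lemma packing_bound k : k_disjoint_bibranchings tail head S T b k ->
  [/\ forall v, v \in T -> k * b v <= din tail head setT v,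
      forall u, u \in S -> k * b u <= dout tail head setT u &
      forall U, bicut_set T U -> k <= #|delta_in tail head U|].
Proof.
case=> F [bib dis]; split=> [v vT|u uS|U cU].
- apply: (disjoint_packing_card dis) => i; have [_ _ /(_ v vT) + _] := bib i.
  by congr (_ <= _); apply: eq_card => a; rewrite !inE.
- apply: (disjoint_packing_card dis) => i; have [_ _ _ /(_ u uS)] := bib i.
  by congr (_ <= _); apply: eq_card => a; rewrite !inE.
- rewrite -(muln1 k); apply: (disjoint_packing_card dis) => i.
  have [a aB aU] := bibranching_covers_bicut (bib i) cU.
  by apply/card_gt0P; exists a; rewrite inE aB.
Qed.

Lemma leq_bibranch_bound k :
  k <= bibranch_bound tail head S T b <->
  [/\ forall v, v \in T -> k * b v <= din tail head setT v,
      forall u, u \in S -> k * b u <= dout tail head setT u &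
      forall U, bicut_set T U -> k <= #|delta_in tail head U|].
Proof.
have [v0 v0T] := set0Pn _ T0.
split=> [kb|[hT hS hC]].
  have kA : k <= #|A|.
    apply: leq_trans kb _; do 2!apply: leq_trans (geq_minl _ _) _.
    elim/big_ind: _ => // [x y xA _|v _]; first exact: leq_trans (geq_minl _ _) xA.
    exact: leq_trans (leq_div _ _) (max_card _).
  move: kb; rewrite !leq_min => /andP[/andP[/(leq_bigminP _ _ kA) hT /(leq_bigminP _ _ kA) hS]].
  move/(leq_bigminP _ _ kA) => hC.
  by split=> // v vX; rewrite -leq_divRL //; [exact: hT|exact: hS].
(* The initial value [#|A|] of the minima must be at least [k]; a vertex of [T] shows it. *)
have kA : k <= #|A|.
  apply: leq_trans (leq_pmulr k (b_gt0 v0)) _; apply: leq_trans (hT v0 v0T) (max_card _).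
rewrite !leq_min -andbA; apply/and3P; split; apply/leq_bigminP => // v vX.
- by rewrite leq_divRL ?hT.
- by rewrite leq_divRL ?hS.
Qed.

(** Arcs from [S] to [T] are the boundary of both sides, the second one in the reversed digraph; a
    single colouring of them therefore serves both. *)
Lemma boundary_arcs_swap : boundary_arcs head tail S = boundary_arcs tail head T.
Proof. by apply/setP=> a; rewrite !inE !in_S negbK andbC. Qed.

Lemma delta_in_swap U : delta_in head tail U = delta_in tail head (~: U).
Proof. by apply/setP=> a; rewrite !inE negbK andbC. Qed.

(** If the vertices of [T] not reachable from [S] formed a nonempty set, an arc of [B] would enter
    it from [S] or from a reachable vertex of [T]. The argument for [S] is the reverse. *)
Lemma cuts_bibranching (B : {set A}) :
  (forall U : {set V}, U != set0 -> U \subset T -> exists2 a, a \in B & a \in delta_in tail head U) ->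
  (forall U : {set V}, U != set0 -> U \subset S -> exists2 a, a \in B & a \in delta_in head tail U) ->
  (forall v, v \in T -> b v <= din tail head B v) ->
  (forall u, u \in S -> b u <= dout tail head B u) ->
  is_bibranching tail head S T b B.
Proof.
move=> cT cS dT dS.
have step a : a \in B -> reach tail head B (tail a) (head a).
  by move=> aB; apply: connect1; apply/exists_inP; exists a; rewrite ?eqxx.
split=> // [v vT|u uS].
  pose U := [set v in T | ~~ [exists s in S, reach tail head B s v]].
  case: (boolP (v \in U)) => [vU|]; last first.
    by rewrite inE vT /= negbK => /exists_inP.
  have [||a aB] := cT U; first by apply/set0Pn; exists v.
  - by apply/subsetP=> w; rewrite inE => /andP[].
  rewrite !inE => /andP[/andP[hT /exists_inP nh]].
  case: (boolP (tail a \in T)) => [tT|]; last first.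
    by rewrite -in_S => tS _; case: nh; exists (tail a) => //; apply: step.
  rewrite negbK => /exists_inP[s sS st]; case: nh; exists s => //.
  exact: connect_trans st (step a aB).
pose U := [set u in S | ~~ [exists t in T, reach tail head B u t]].
case: (boolP (u \in U)) => [uU|]; last first.
  by rewrite inE uS /= negbK => /exists_inP.
have [||a aB] := cS U; first by apply/set0Pn; exists u.
- by apply/subsetP=> w; rewrite inE => /andP[].
rewrite !inE => /andP[/andP[tS /exists_inP nh]].
case: (boolP (head a \in S)) => [hS|]; last first.
  by rewrite in_S negbK => hT _; case: nh; exists (head a) => //; apply: step.
rewrite negbK => /exists_inP[t tT st]; case: nh; exists t => //.
exact: connect_trans (step a aB) st.
Qed.

Lemma packing_exists k :
  (forall v, v \in T -> k * b v <= din tail head setT v) ->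
  (forall u, u \in S -> k * b u <= dout tail head setT u) ->
  (forall U, bicut_set T U -> k <= #|delta_in tail head U|) ->
  k_disjoint_bibranchings tail head S T b k.
Proof.
move=> dT dS cut.
have cutT (U : {set V}) : U != set0 -> U \subset T -> k <= #|delta_in tail head U|.
  by move=> U0 UT; apply: cut; rewrite /bicut_set U0 UT.
have cutS (U : {set V}) : U != set0 -> U \subset S -> k <= #|delta_in head tail U|.
  move=> U0 US; rewrite delta_in_swap; apply: cut; apply/orP; right.
  (* The complement of a nonempty subset of [S] contains [T] and is proper, hence it defines a
     bicut. *)
  rewrite -setCS setCK; have -> : ~: T = S by apply/setP=> v; rewrite inE in_S.
  rewrite US; apply: contra U0 => /eqP E; by rewrite -(setCK U) E setCT.
have boundsS := kernel_bounds dS cutS; rewrite boundary_arcs_swap in boundsS.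
have [c [dom covT covS]] := @supermodular_coloring A _ _ _ _ (@split_head V A) (@split_head V A) k
  (boundary_arcs tail head T) _ _ 
  (@kernel_super _ _ tail head T b k) (@kernel_super _ _ head tail S b k)
  (kernel_bounds dT cutT) boundsS.
have [cT [extT newT hitT degT]] := boundary_coloring_extends dom covT.
have domS a j : c a = Some j -> a \in boundary_arcs head tail S /\ j < k.
  by rewrite boundary_arcs_swap; apply: dom.
have [cS [extS newS hitS degS]] := boundary_coloring_extends domS covS.
exists (fun i : 'I_k => [set a | (cT a == Some (i : nat)) || (cS a == Some (i : nat))]); split=> [i|i j ij].
  apply: cuts_bibranching => [U U0 UT|U U0 US|v vT|u uS].
  - by have [a ca aU] := hitT _ _ (ltn_ord i) U0 UT; exists a; rewrite // inE ca eqxx.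
  - by have [a ca aU] := hitS _ _ (ltn_ord i) U0 US; exists a; rewrite // inE ca eqxx orbT.
  - apply: leq_trans (degT _ _ (ltn_ord i) vT) _; apply: subset_leq_card.
    by apply/subsetP=> a; rewrite !inE => /andP[-> ->].
  - apply: leq_trans (degS _ _ (ltn_ord i) uS) _; apply: subset_leq_card.
    by apply/subsetP=> a; rewrite !inE => /andP[-> ->]; rewrite orbT.
(* Both extensions agree with [c] where it is defined; any other arc coloured by [cT] lies inside
   [T], and one coloured by [cS] inside [S]. *)
have clash a (i' j' : 'I_k) : i' != j' -> cT a = Some (i' : nat) -> cS a = Some (j' : nat) -> False.
  move=> ne cTa cSa; case ca: (c a) => [n|].
    move: ne; rewrite -val_eqE /=; have := extT a; have := extS a; rewrite ca cTa cSa.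
    by move=> /(_ isT)[->] /(_ isT)[->]; rewrite eqxx.
  have := newT a; have := newS a; rewrite ca cTa cSa => /(_ isT erefl) + /(_ isT erefl).
  by rewrite !inE !in_S => /andP[_ /negPf->].
rewrite -setI_eq0; apply/eqP/setP=> a; rewrite !inE.
apply/negP => /andP[/orP[]/eqP ci /orP[]/eqP cj].
- by move: ij; rewrite -val_eqE /=; move: cj; rewrite ci => -[->]; rewrite eqxx.
- exact: clash ij ci cj.
- by apply: clash _ cj ci; rewrite eq_sym.
- by move: ij; rewrite -val_eqE /=; move: cj; rewrite ci => -[->]; rewrite eqxx.
Qed.
End Digraph.

Theorem mainTheorem4 (V A : finType) (tail head : A -> V)
  (S T : {set V}) (b : V -> nat) :
  (forall a, tail a != head a) ->
  S :&: T = set0 -> S :|: T = setT -> S != set0 -> T != set0 ->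
  (forall a, tail a \in T -> head a \notin S) ->
  (forall v, 0 < b v) ->
  k_disjoint_bibranchings tail head S T b (bibranch_bound tail head S T b) /\
  (forall k, k_disjoint_bibranchings tail head S T b k ->
             k <= bibranch_bound tail head S T b).
Proof.
move=> _ ST0 STT _ T0 _ b_gt0; split=> [|k packing].
  have /(leq_bibranch_bound _ _ _ T0 b_gt0)[dT dS cut] := leqnn (bibranch_bound tail head S T b).
  exact: packing_exists.
exact/(leq_bibranch_bound _ _ _ T0 b_gt0)/packing_bound.
Qed.
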